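(* Let $\mathcal{M}$ be a regular oriented matroid on $n$ elements and let $M$ be a unimodular $d\times n$ matrix representing $\mathcal{M}$ over $\mathbb{R}$. Then the subgroup of $\mathbb{Z}^n$ generated by the columns of $M^{\top}$ (that is, by the rows of $M$) coincides with the subgroup of $\mathbb{Z}^n$ generated by the cocircuits of $\mathcal{M}$.
   Context: An integer $d\times n$ matrix $M$ of rank $r$ is unimodular if all its maximal (i.e. $r\times r$) minors lie in $\{-1,0,1\}$; $M$ is not required to have full row rank. For a real matrix $M$ with columns $a_1,\dots,a_n\in\mathbb{R}^d$, the oriented matroid $\mathcal{M}(M)$ represented by $M$ has as covectors the sign vectors $(\operatorname{sign} f(a_1),\dots,\operatorname{sign} f(a_n))\in\{-1,0,1\}^n$, where $f$ ranges over all linear functionals $f:\mathbb{R}^d\to\mathbb{R}$. The cocircuits of $\mathcal{M}(M)$ are the minimal elements among the nonzero covectors, with respect to the partial order on $\{-1,0,1\}^n$ obtained by extending $0\prec\pm1$ componentwise. ''$M$ represents $\mathcal{M}$ over $\mathbb{R}$'' means $\mathcal{M}=\mathcal{M}(M)$. An oriented matroid is regular if its underlying (unoriented) matroid is regular, i.e. representable over $\mathbb{R}$ by a unimodular matrix. Cocircuits are regarded as vectors in $\mathbb{Z}^n$. *)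

(* Defs.v *)
From HB Require Import structures.
From mathcomp Require Import all_boot all_order all_algebra.
From mathcomp Require Import mathcomp_extra boolp classical_sets reals.
From mathcomp Require Import ring lra.

Set Implicit Arguments.
Unset Strict Implicit.
Unset Printing Implicit Defensive.

Import Order.TTheory GRing.Theory Num.Theory.
Local Open Scope classical_set_scope.
Local Open Scope ring_scope.

(* Sign vectors are integer row vectors with entries in {-1, 0, 1}, so that
   cocircuits are literally elements of Z^n. *)
Definition is_sign_vector (n : nat) (X : 'rV[int]_n) : Prop :=
  forall i, X 0 i \in [:: -1; 0; 1].

Definition sign_comp (n : nat) (X Y : 'rV[int]_n) : 'rV[int]_n :=
  \row_i (if X 0 i == 0 then Y 0 i else X 0 i).

Definition separates (n : nat) (X Y : 'rV[int]_n) (e : 'I_n) : Prop :=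
  X 0 e <> 0 /\ X 0 e = - Y 0 e.

Definition sign_le (n : nat) (X Y : 'rV[int]_n) : Prop :=
  forall i, X 0 i = 0 \/ X 0 i = Y 0 i.

(* Oriented matroids on {0, ..., n-1}, by the covector axioms. *)
Record orientedMatroid (n : nat) := OrientedMatroid {
  covectors : set 'rV[int]_n;
  covector_sign : forall X, covectors X -> is_sign_vector X;
  covector0 : covectors 0;
  covectorN : forall X, covectors X -> covectors (- X);
  covector_comp : forall X Y,
    covectors X -> covectors Y -> covectors (sign_comp X Y);
  covector_elim : forall X Y e,
    covectors X -> covectors Y -> separates X Y e ->
    exists Z, [/\ covectors Z, Z 0 e = 0 &
      forall f, ~ separates X Y f -> Z 0 f = sign_comp X Y 0 f]
}.

Definition cocircuits (n : nat) (O : orientedMatroid n) : set 'rV[int]_n :=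
  [set X | [/\ covectors O X, X <> 0 &
    forall Y, covectors O Y -> Y <> 0 -> sign_le Y X -> Y = X]].

(* Matroids on {0, ..., n-1}, by the closure axioms. *)
Record matroid (n : nat) := Matroid {
  mcl : set 'I_n -> set 'I_n;
  mcl_sub : forall S, S `<=` mcl S;
  mcl_mono : forall S T, S `<=` T -> mcl S `<=` mcl T;
  mcl_idem : forall S, mcl (mcl S) = mcl S;
  mcl_exchange : forall S e f,
    mcl (e |` S) f -> ~ mcl S f -> mcl (f |` S) e
}.

Section Underlying.
Variables (n : nat) (O : orientedMatroid n).

(* The flats of the underlying matroid are the zero sets of the covectors, so
   the closure of S is the set of elements on which every covector vanishing
   on S vanishes. *)
Definition underlying_cl (S : set 'I_n) : set 'I_n :=
  [set e | forall X, covectors O X -> (forall i, S i -> X 0 i = 0) ->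
     X 0 e = 0].

Lemma underlying_cl_sub S : S `<=` underlying_cl S.
Proof. by move=> e Se X _; apply. Qed.

Lemma underlying_cl_mono S T :
  S `<=` T -> underlying_cl S `<=` underlying_cl T.
Proof. by move=> ST e He X LX XT; apply: He => // i /ST; apply: XT. Qed.

Lemma underlying_cl_idem S :
  underlying_cl (underlying_cl S) = underlying_cl S.
Proof.
apply/seteqP; split; last exact: underlying_cl_sub.
by move=> e He X LX XS; apply: He => // i; apply.
Qed.

Lemma underlying_cl_exchange S e f :
  underlying_cl (e |` S) f -> ~ underlying_cl S f -> underlying_cl (f |` S) e.
Proof.
move=> Hf nHf Y LY YS; apply: contra_notP nHf => Ye X LX XS.
have Yf : Y 0 f = 0 by apply: YS; left.
have YS' i : S i -> Y 0 i = 0 by move=> Si; apply: YS; right.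
apply: contrapT => Xf.
have Xe : X 0 e <> 0.
  by move=> Xe; apply: Xf; apply: Hf => // i [->//|]; apply: XS.
have [Y' [LY' Y'f Y'S sep]] : exists Y',
    [/\ covectors O Y', Y' 0 f = 0, forall i, S i -> Y' 0 i = 0
      & separates X Y' e].
  have: X 0 e = - Y 0 e \/ X 0 e = Y 0 e.
    have := covector_sign LX e; have := covector_sign LY e.
    rewrite !inE => /or3P[]/eqP Ye' /or3P[]/eqP Xe';
      by [case: Ye|case: Xe|left; rewrite Xe' Ye' ?opprK|right; rewrite Xe' Ye'].
  case=> XY; first by exists Y.
  exists (- Y); split; first exact: covectorN.
  - by rewrite mxE Yf oppr0.
  - by move=> i /YS' Yi; rewrite mxE Yi oppr0.
  - by split=> //; rewrite mxE opprK.
have [Z [LZ Ze Zf]] := covector_elim LX LY' sep.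
have nsep i : Y' 0 i = 0 -> ~ separates X Y' i.
  by move=> Yi [Xi]; rewrite Yi oppr0.
have : Z 0 f = 0.
  apply: Hf => // i [->//|Si].
  by rewrite Zf ?mxE ?XS ?eqxx ?Y'S//; apply: nsep; apply: Y'S.
by rewrite Zf ?mxE; [case: eqP|exact: nsep].
Qed.

Definition underlying : matroid n :=
  Matroid underlying_cl_sub underlying_cl_mono underlying_cl_idem
    underlying_cl_exchange.

End Underlying.

Section Represented.
Variables (R : realType) (d n : nat) (A : 'M[R]_(d, n)).

Definition mx_covectors : set 'rV[int]_n :=
  [set X | exists f : {scalar 'cV[R]_d}, X = \row_i sgz (f (col i A))].

Lemma scalar_comb (f g : {scalar 'cV[R]_d}) (a b : R) :
  exists h : {scalar 'cV[R]_d}, forall x, h x = a * f x + b * g x.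
Proof.
pose h x := a * f x + b * g x.
have hlin : scalar h by move=> k u v; rewrite /h !linearP /=; ring.
pose hL := GRing.isLinear.Build R 'cV[R]_d R *%R h hlin.
by exists (HB.pack h hL : {scalar 'cV[R]_d}).
Qed.

Lemma mx_covector_sign X : mx_covectors X -> is_sign_vector X.
Proof.
move=> [f ->] i; rewrite mxE.
by have [fi|fi|fi] := ltgtP (f (col i A)) 0;
  rewrite ?(ltr0_sgz fi) ?(gtr0_sgz fi) ?fi ?sgz0.
Qed.

Lemma mx_covector0 : mx_covectors 0.
Proof.
exists (\0 : {linear 'cV[R]_d -> R | *%R}).
by apply/rowP => i; rewrite !mxE sgz0.
Qed.

Lemma mx_covectorN X : mx_covectors X -> mx_covectors (- X).
Proof.
move=> [f ->]; have [h hE] := scalar_comb f f (-1) 0; exists h.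
by apply/rowP => i; rewrite !mxE hE mul0r addr0 mulN1r sgzN.
Qed.

Lemma mx_covector_comp X Y :
  mx_covectors X -> mx_covectors Y -> mx_covectors (sign_comp X Y).
Proof.
move=> [f ->] [g ->].
pose q i : R := `|g (col i A)| / `|f (col i A)|.
pose c : R := 1 + \sum_i q i.
have q0 i : 0 <= q i by rewrite divr_ge0.
have c0 : 0 < c by rewrite ltr_pwDl// sumr_ge0.
have qc i : q i < c.
  rewrite /c (bigD1 i)//= addrCA ltrDl ltr_pwDl// sumr_ge0//.
have [h hE] := scalar_comb f g c 1; exists h.
apply/rowP => i; rewrite !mxE hE mul1r sgz_eq0.
have [->|fi0] := eqVneq (f (col i A)) 0; first by rewrite mulr0 add0r.
have := qc i; rewrite /q ltr_pdivrMr ?normr_gt0// => lt.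
case: (ltgtP (f (col i A)) 0) fi0 lt => // fi _.
  rewrite (ltr0_norm fi) ltr_norml (ltr0_sgz fi) => /andP[lt1 lt2].
  by rewrite ltr0_sgz//; lra.
rewrite (gtr0_norm fi) ltr_norml (gtr0_sgz fi) => /andP[lt1 lt2].
by rewrite gtr0_sgz//; lra.
Qed.

Lemma mx_covector_elim X Y e :
  mx_covectors X -> mx_covectors Y -> separates X Y e ->
  exists Z, [/\ mx_covectors Z, Z 0 e = 0 &
    forall f, ~ separates X Y f -> Z 0 f = sign_comp X Y 0 f].
Proof.
move=> [f ->] [g ->]; rewrite /separates !mxE => -[fe fge].
pose a := `|g (col e A)|; pose b := `|f (col e A)|.
have b0 : 0 < b by rewrite normr_gt0 -sgz_eq0; apply/eqP.
have a0 : 0 < a.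
  by rewrite normr_gt0 -sgz_eq0; apply/eqP => g0; apply: fe; rewrite fge g0.
exists (\row_i sgz (a * f (col i A) + b * g (col i A))); split.
- have [h hE] := scalar_comb f g a b; exists h.
  by apply/rowP => i; rewrite !mxE hE.
- rewrite mxE; apply/eqP; rewrite sgz_eq0 /a /b; apply/eqP.
  have sfg : Num.sg (f (col e A)) = - Num.sg (g (col e A)).
    by rewrite !sgrEz fge mulrNz.
  rewrite [X in _ * X + _]numEsg [X in _ + _ * X]numEsg sfg mulNr mulrN.
  by rewrite addrC; apply/eqP; rewrite subr_eq0; apply/eqP; ring.
move=> i; rewrite !mxE sgz_eq0 => nsep.
have [fi|fi|fi] := ltgtP (f (col i A)) 0.
- rewrite (ltr0_sgz fi) in nsep *.
  rewrite ltr0_sgz//; apply: ltr_nwDl; first by rewrite pmulr_rlt0.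
  rewrite pmulr_rle0// leNgt; apply/negP => gi.
  by apply: nsep; rewrite (gtr0_sgz gi).
- rewrite (gtr0_sgz fi) in nsep *.
  rewrite gtr0_sgz//; apply: ltr_pwDl; first exact: mulr_gt0.
  rewrite mulr_ge0 ?(ltW b0)// leNgt; apply/negP => gi.
  by apply: nsep; rewrite (ltr0_sgz gi).
- by rewrite fi mulr0 add0r sgzM (gtr0_sgz b0) mul1r.
Qed.

Definition mx_oriented_matroid : orientedMatroid n :=
  OrientedMatroid mx_covector_sign mx_covector0 mx_covectorN mx_covector_comp
    mx_covector_elim.

Definition mx_cols (S : set 'I_n) : seq 'cV[R]_d := [seq col i A | i in S].

Definition mx_cl (S : set 'I_n) : set 'I_n :=
  [set e | col e A \in <<mx_cols S>>%VS].

Lemma mx_cols_span S (U : {vspace 'cV[R]_d}) :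
  (forall i, S i -> col i A \in U) -> (<<mx_cols S>> <= U)%VS.
Proof.
move=> SU; apply/span_subvP => v /mapP[i]; rewrite mem_enum => iS ->.
by apply: SU; rewrite -in_setE.
Qed.

Lemma mx_cl_sub S : S `<=` mx_cl S.
Proof.
by move=> e Se; apply: memv_span; apply: map_f; rewrite mem_enum in_setE.
Qed.

Lemma mx_cl_mono S T : S `<=` T -> mx_cl S `<=` mx_cl T.
Proof.
move=> ST e; apply: subvP; apply: mx_cols_span => i /ST.
exact: mx_cl_sub.
Qed.

Lemma mx_cl_idem S : mx_cl (mx_cl S) = mx_cl S.
Proof.
apply/seteqP; split; last exact: mx_cl_sub.
by move=> e; apply: subvP; apply: mx_cols_span.
Qed.

Lemma mx_cl_exchange S e f :
  mx_cl (e |` S) f -> ~ mx_cl S f -> mx_cl (f |` S) e.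
Proof.
rewrite /mx_cl /= => Hf nHf.
have : col f A \in (<[col e A]> + <<mx_cols S>>)%VS.
  apply: (subvP _ _ Hf); apply: mx_cols_span => i [->|Si].
    by apply: (subvP (addvSl _ _)); exact: memv_line.
  by apply: (subvP (addvSr _ _)); exact: mx_cl_sub.
move=> /memv_addP[_ /vlineP[k ->] [v vS fE]].
have k0 : k != 0.
  by apply/eqP => k0; apply: nHf; rewrite fE k0 scale0r add0r.
have -> : col e A = k^-1 *: (col f A - v).
  by rewrite fE addrK scalerA mulVf// scale1r.
rewrite memvZ// memvB//; first by apply: mx_cl_sub; left.
apply: (subvP _ _ vS); apply: mx_cols_span => i Si.
by apply: mx_cl_sub; right.
Qed.

Definition mx_matroid : matroid n :=
  Matroid mx_cl_sub mx_cl_mono mx_cl_idem mx_cl_exchange.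

End Represented.

(* Full row rank is not required: r is the rank of M over the rationals.  The
   maximal minors are indexed by strictly increasing choices of r rows and of
   r columns. *)
Definition unimodular (d n : nat) (M : 'M[int]_(d, n)) : Prop :=
  let r := \rank (map_mx intr M : 'M[rat]_(d, n)) in
  forall (f : 'I_r -> 'I_d) (g : 'I_r -> 'I_n),
    {homo f : i j / (i < j)%N} -> {homo g : i j / (i < j)%N} ->
    \det (mxsub f g M) \in [:: -1; 0; 1].

Definition represents (R : realType) (d n : nat) (M : 'M[int]_(d, n))
    (O : orientedMatroid n) : Prop :=
  O = mx_oriented_matroid (map_mx intr M : 'M[R]_(d, n)).

Definition regular_matroid (R : realType) (n : nat) (N : matroid n) : Prop :=
  exists (d : nat) (M : 'M[int]_(d, n)),
    unimodular M /\ N = mx_matroid (map_mx intr M : 'M[R]_(d, n)).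

Definition regular_oriented_matroid (R : realType) (n : nat)
    (O : orientedMatroid n) : Prop :=
  regular_matroid R (underlying O).

Definition subgroup_generated (V : zmodType) (G : set V) : set V :=
  smallest [set H : set V | zmod_closed (mem H)] G.

(* Main.v *)
(* Let L be the group generated by the rows of M, so that its elements are the
   y M with y integral.  Choosing a nonzero maximal minor adapted to the zero
   set of a given nonzero vector v of the real row space, and inverting it, one
   finds a nonzero sign vector in L supported in the support of v.  Applied to
   a vector v whose sign vector is a cocircuit X, this forces X to be up to
   sign that element of L.  Conversely, subtracting from a nonzero x in L a
   multiple of a cocircuit below its sign vector stays in L and shrinks the
   support, hence x is an integral combination of cocircuits. *)

Require Import Defs.
From HB Require Import structures.
From mathcomp Require Import all_boot all_order all_algebra.
From mathcomp Require Import mathcomp_extra boolp classical_sets reals.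
From mathcomp Require Import perm.

Set Implicit Arguments.
Unset Strict Implicit.
Unset Printing Implicit Defensive.

Import Order.TTheory GRing.Theory Num.Theory.
Local Open Scope classical_set_scope.
Local Open Scope ring_scope.

(** * Generated subgroups *)

Lemma subgroup_generated_closed (V : zmodType) (G : set V) :
  zmod_closed (mem (subgroup_generated G)).
Proof.
split=> [|u v]; first by rewrite inE => H [[H0 _] _]; rewrite -in_setE.
rewrite !inE => Gu Gv H [Hc GH].
have [_ HB] := Hc; rewrite -in_setE; apply: HB; rewrite inE.
  exact: Gu.
exact: Gv.
Qed.

Lemma subgroup_generated_sub (V : zmodType) (G H : set V) :
  G `<=` subgroup_generated H -> subgroup_generated G `<=` subgroup_generated H.
Proof. by apply: smallest_sub; exact: subgroup_generated_closed. Qed.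

Section SubgroupGenerated.
Variables (V : zmodType) (G : set V).
Local Notation S := (subgroup_generated G).

Lemma subgroup_generated0 : S 0.
Proof. by have [S0 _] := subgroup_generated_closed G; rewrite inE in S0. Qed.

Lemma subgroup_generatedB u v : S u -> S v -> S (u - v).
Proof.
have [_ SB] := subgroup_generated_closed G.
by move=> Su Sv; have := SB u v; rewrite !inE; apply.
Qed.

Lemma subgroup_generatedN u : S u -> S (- u).
Proof.
by move=> Su; rewrite -sub0r; apply: subgroup_generatedB => //;
  exact: subgroup_generated0.
Qed.

Lemma subgroup_generatedD u v : S u -> S v -> S (u + v).
Proof.
move=> Su Sv; rewrite -[v]opprK; apply: subgroup_generatedB => //.
exact: subgroup_generatedN.
Qed.

Lemma subgroup_generated_mulrz u (k : int) : S u -> S (u *~ k).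
Proof.
have SMn m : S u -> S (u *+ m).
  move=> Su; elim: m => [|m IH]; first exact: subgroup_generated0.
  by rewrite mulrS; exact: subgroup_generatedD.
move=> Su; case: k => m; first exact: SMn.
by rewrite NegzE mulrNz; apply: subgroup_generatedN; exact: SMn.
Qed.

Lemma subgroup_generated_sum (I : finType) (F : I -> V) :
  (forall i, S (F i)) -> S (\sum_i F i).
Proof.
move=> SF; apply: big_ind => //; first exact: subgroup_generated0.
exact: subgroup_generatedD.
Qed.

End SubgroupGenerated.

Lemma scale_int_mulrz (n : nat) (k : int) (u : 'rV[int]_n) : k *: u = u *~ k.
Proof. by rewrite -scaler_int intz. Qed.

Lemma subgroup_generated_mulmx (d n : nat) (M : 'M[int]_(d, n)) (y : 'rV[int]_d) :
  subgroup_generated (range (fun i => row i M)) (y *m M).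
Proof.
rewrite mulmx_sum_row; apply: subgroup_generated_sum => i.
rewrite scale_int_mulrz; apply: subgroup_generated_mulrz.
by apply: sub_gen_smallest; exists i.
Qed.

(** * Minors and integral reduced forms of unimodular matrices *)

(** Ranking each index by the number of smaller values of [f] gives a permutation, whose inverse
    sorts [f]. This reduces arbitrary selections to the increasing ones in [unimodular]. *)
Lemma exists_sorting_perm (r d : nat) (f : 'I_r -> 'I_d) : injective f ->
  exists s : 'S_r, {homo (fun i => f (s i)) : i j / (i < j)%N}.
Proof.
move=> finj.
pose rho (i : 'I_r) : nat := #|[set j | (f j < f i)%N]%SET|.
have rho_lt i : (rho i < r)%N.
  rewrite -[X in (_ < X)%N]card_ord -cardsT; apply: proper_card.
  rewrite properT; apply/negP => /eqP/setP/(_ i).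
  by rewrite !inE ltnn.
have rho_mono i j : (f i < f j)%N -> (rho i < rho j)%N.
  move=> fij; apply: proper_card; apply/fintype.properP; split.
    by apply/fintype.subsetP => k; rewrite !inE => /ltn_trans; apply.
  by exists i; rewrite inE ?ltnn.
pose rh i := Ordinal (rho_lt i).
have rinj : injective rh.
  move=> i j /(congr1 val) /= eij; apply: finj; apply: val_inj.
  by case: (ltngtP (f i) (f j)) => // /rho_mono; rewrite eij ltnn.
exists (perm rinj)^-1%g => i j ij.
set a := (perm rinj)^-1%g i; set b := (perm rinj)^-1%g j.
have ia : i = rh a by rewrite -(permE rinj) permKV.
have jb : j = rh b by rewrite -(permE rinj) permKV.
case: (ltngtP (f a) (f b)) => //.
  by move=> /rho_mono; move: ij; rewrite ia jb /= => /ltn_trans h /h; rewrite ltnn.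
by move=> /val_inj/finj ab; move: ij; rewrite ia jb ab ltnn.
Qed.

Lemma mem_sign (x : int) : (x \in [:: -1; 0; 1]) = (`|x| <= 1).
Proof. by case: x => [[|[|m]]|[|m]]. Qed.

(** Outside column [i] this is the identity matrix, so the expansion along row [i] has a single
    term, with identity cofactor matrix. *)
Lemma det_replace_col (R : comNzRingType) (r : nat) (Q : 'M[R]_r) (i : 'I_r) :
  (forall j k, k != i -> Q j k = (j == k)%:R) -> \det Q = Q i i.
Proof.
move=> Qk; rewrite (expand_det_row _ i) (bigD1 i) //= big1 ?addr0 => [|k ki];
  last by rewrite Qk // eq_sym (negPf ki) mul0r.
rewrite /cofactor -signr_odd oddD addbb mul1r.
suff -> : row' i (col' i Q) = 1%:M by rewrite det1 mulr1.
apply/matrixP => j k; rewrite !mxE Qk; last by rewrite eq_sym neq_lift.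
by rewrite (inj_eq lift_inj).
Qed.

Section Unimodular.
Variables (d n : nat) (M : 'M[int]_(d, n)).
Hypothesis uM : unimodular M.
Let Mq : 'M[rat]_(d, n) := map_mx intr M.
Let r := \rank Mq.

(** A repeated index makes the minor zero; otherwise sorting rows and columns changes only its
    sign. *)
Lemma unimodular_minor (f : 'I_r -> 'I_d) (g : 'I_r -> 'I_n) :
  \det (mxsub f g M) \in [:: -1; 0; 1].
Proof.
have [/injectiveP finj|/injectivePn[i [j ij fij]]] := boolP (injectiveb f);
  last first.
  by rewrite (determinant_alternate ij) ?inE // => k; rewrite !mxE fij.
have [/injectiveP ginj|/injectivePn[i [j ij gij]]] := boolP (injectiveb g);
  last first.
  rewrite -det_tr (determinant_alternate ij) ?inE // => k.
  by rewrite !mxE gij.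
have [s sf] := exists_sorting_perm finj.
have [t tg] := exists_sorting_perm ginj.
have := uM sf tg.
have -> : mxsub (fun i => f (s i)) (fun i => g (t i)) M =
          row_perm s (col_perm t (mxsub f g M)).
  by apply/matrixP => i j; rewrite !mxE.
by rewrite row_permE col_permE !det_mulmx !det_perm !mem_sign
           normrMsign normrM normr_sign mulr1.
Qed.

Lemma nonzero_minor : exists (f : 'I_r -> 'I_d) (g : 'I_r -> 'I_n),
  \det (mxsub f g M) != 0.
Proof.
pose f := maxrankfun Mq.
have full : row_full (rowsub f Mq)^T.
  by rewrite /row_full mxrank_tr; exact: maxrowsub_free.
exists f, (fullrankfun full).
have := fullrowsub_unit full; rewrite unitmxE unitfE -det_tr.
suff -> : (rowsub (fullrankfun full) (rowsub f Mq)^T)^T =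
   map_mx intr (mxsub f (fullrankfun full) M) by rewrite det_map_mx intr_eq0.
by apply/matrixP => i j; rewrite !mxE.
Qed.

(** Over the rationals the rows chosen by [f] span the row space, so [M = C *m rowsub f M] for some
    [C]. Restricting to the columns [g] gives [colsub g M = C *m mxsub f g M], and multiplying by
    [N] recovers [M]. *)
Lemma mul_colsub_unit (f : 'I_r -> 'I_d) (g : 'I_r -> 'I_n) (N : 'M[int]_(r, n)) :
  \det (mxsub f g M) != 0 -> mxsub f g M *m N = rowsub f M ->
  M = colsub g M *m N.
Proof.
move=> B0 BN.
have fM : (rowsub f Mq <= Mq)%MS by rewrite rowsubE submxMl.
have Bu : mxsub f g Mq \in unitmx.
  by rewrite unitmxE unitfE /Mq -map_mxsub det_map_mx intr_eq0.
have rkf : \rank (rowsub f Mq) = r.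
  apply/eqP; rewrite eqn_leq (mxrankS fM) /=.
  have := mxrankM_maxl (rowsub f Mq) (colsub g 1%:M).
  rewrite mulmx_colsub mulmx1 (_ : colsub g _ = mxsub f g Mq) ?mxrank_unit //.
  by apply/matrixP => i j; rewrite !mxE.
have : (Mq <= rowsub f Mq)%MS.
  by rewrite -(mxrank_leqif_sup fM) rkf.
case/submxP => C MC.
have BNq : mxsub f g Mq *m map_mx intr N = rowsub f Mq.
  by rewrite /Mq -!map_mxsub -map_mxM BN.
have gq : colsub g Mq = C *m mxsub f g Mq.
  rewrite [in LHS]MC -mulmx_colsub; congr (_ *m _).
  by apply/matrixP => i j; rewrite !mxE.
have MNq : Mq = map_mx intr (colsub g M *m N).
  by rewrite map_mxM map_mxsub -/Mq gq -mulmxA BNq.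
apply/matrixP => i j; apply: (@intr_inj rat).
by have /matrixP/(_ i j) := MNq; rewrite !mxE.
Qed.

(* Among the nonzero maximal minors take one whose columns meet Z as much as
   possible.  In the reduced form N, a row whose pivot lies outside Z vanishes
   on Z, since otherwise exchanging the pivot would improve the choice. *)
Lemma adapted_reduced_form (Z : pred 'I_n) :
  exists (g : 'I_r -> 'I_n) (D : 'M[int]_(r, d)) (N : 'M[int]_(r, n)),
    [/\ N = D *m M, M = colsub g M *m N,
        forall i, N i (g i) = 1,
        forall i k, N i k \in [:: -1; 0; 1] &
        forall i k, ~~ Z (g i) -> Z k -> N i k = 0].
Proof.
have [f0 [g0 fg0]] := nonzero_minor.
pose P (p : {ffun 'I_r -> 'I_d} * {ffun 'I_r -> 'I_n}) :=
  \det (mxsub p.1 p.2 M) != 0.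
have P0 : P (finfun f0, finfun g0).
  rewrite /P (_ : mxsub _ _ _ = mxsub f0 g0 M) //.
  by apply/matrixP => i j; rewrite !mxE !ffunE.
pose F (p : {ffun 'I_r -> 'I_d} * {ffun 'I_r -> 'I_n}) := #|[set i | Z (p.2 i)]%SET|.
case: (@arg_maxnP _ _ P F P0) => -[f g]; rewrite /P /F /= => B0 maxB.
set B := mxsub f g M in B0.
have detB : \det B = -1 \/ \det B = 1.
  have := unimodular_minor f g; rewrite -/B !inE (negPf B0) /=.
  by case/orP => /eqP; [left|right].
(* Determinant 1 or -1 makes [B] invertible over the integers, so [N] and the coefficients
   expressing it through [M] are integral. *)
have Bu : B \in unitmx by rewrite unitmxE; case: detB => ->.
pose N := invmx B *m rowsub f M.
have BN : B *m N = rowsub f M by rewrite mulKVmx.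
have gN : colsub g N = 1%:M.
  rewrite -mulmx_colsub (_ : colsub _ _ = B) ?mulVmx //.
  by apply/matrixP => i j; rewrite !mxE.
(* Exchanging pivot [g i] for column [k] multiplies the minor by [N i k]. This shows both that the
   entries of [N] are signs and that an exchange at a nonzero entry keeps the minor nonzero. *)
pose g' i k : {ffun 'I_r -> 'I_n} := [ffun j => if j == i then k else g j].
have detg' i k : \det (mxsub f (g' i k) M) = \det B * N i k.
  have -> : mxsub f (g' i k) M = B *m colsub (g' i k) N.
    by rewrite mulmx_colsub BN; apply/matrixP => a b; rewrite !mxE.
  rewrite det_mulmx (@det_replace_col _ _ (colsub (g' i k) N) i) => [|j l li].
    by rewrite [mxsub _ _ _ _ _]mxE /g' ffunE eqxx.
  have := congr1 (fun A : 'M_r => A j l) gN.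
  rewrite [mxsub _ _ _ _ _]mxE [1%:M _ _]mxE.
  by rewrite [mxsub _ _ _ _ _]mxE /g' ffunE (negPf li).
exists g, (invmx B *m rowsub f 1%:M), N; split.
- by rewrite -mulmxA -rowsubE.
- exact: (@mul_colsub_unit f).
- by move=> i; have := congr1 (fun A : 'M_r => A i i) gN; rewrite mxE [in RHS]mxE eqxx.
- move=> i k; have := unimodular_minor f (g' i k); rewrite detg'.
  rewrite !mem_sign normrM; by case: detB => ->; rewrite mul1r.
- move=> i k Zgi Zk; apply/eqP; apply: contraT => Nik.
  have := maxB (f, g' i k); rewrite /= detg' mulf_neq0 // => /(_ isT).
  rewrite leqNgt => /negP[]; apply: proper_card; apply/fintype.properP; split.
    apply/fintype.subsetP => j; rewrite !inE /g' ffunE.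
    by case: (j =P i) => [->|//]; rewrite (negPf Zgi).
  by exists i; rewrite inE /g' ?ffunE ?eqxx.
Qed.

(** The coordinates of [v] in the rows of the reduced form [N] adapted to its zero set are its
    entries at the pivots. Some pivot thus lies in the support of [v], and the corresponding row of
    [N] is the required vector. *)
Lemma sign_vector_in_support (R : realType) (v : 'rV[R]_n) :
  (v <= (map_mx intr M : 'M[R]_(d, n)))%MS -> v != 0 ->
  exists (y : 'rV[int]_d) (e : 'I_n),
    [/\ (y *m M) 0 e = 1, is_sign_vector (y *m M) &
        forall k, v 0 k = 0 -> (y *m M) 0 k = 0].
Proof.
case/submxP => z vz v0.
have [g [D [N [ND MN N1 Ns N0]]]] := adapted_reduced_form (fun k => v 0 k == 0).
have vN : v = colsub g v *m map_mx intr N.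
  have MNR := congr1 (map_mx (intr : int -> R)) MN.
  rewrite map_mxM map_mxsub in MNR.
  by rewrite [LHS]vz [in LHS]MNR mulmxA mulmx_colsub -vz.
have [i vi] : exists i, v 0 (g i) != 0.
  apply/existsP; apply: contraNT v0; rewrite negb_exists => /forallP v0.
  rewrite vN (_ : colsub g v = 0) ?mul0mx //.
  apply/rowP => i; rewrite !mxE; apply/eqP; have := v0 i.
  by rewrite negbK.
have rowE k : (row i D *m M) 0 k = N i k by rewrite -row_mul -ND mxE.
exists (row i D), (g i); split; first by rewrite rowE.
  by move=> k; rewrite rowE.
by move=> k vk; rewrite rowE N0 // vk.
Qed.

End Unimodular.

(** * Covectors, signs and supports *)

(** A functional is left multiplication by the row of its values on the standard basis. *)
Lemma mx_covectorsP (R : realType) (d n : nat) (A : 'M[R]_(d, n)) (X : 'rV[int]_n) :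
  mx_covectors A X <-> exists2 v : 'rV[R]_n, (v <= A)%MS & X = \row_i sgz (v 0 i).
Proof.
split=> [[f ->]|[v /submxP[y ->] ->]].
  exists (\row_i f (col i A)); last by apply/rowP => i; rewrite !mxE.
  apply/submxP; exists (\row_j f (delta_mx j 0)); apply/rowP => i.
  rewrite !mxE [in LHS](matrix_sum_delta (col i A)) linear_sum.
  by apply: eq_bigr => j _; rewrite big_ord1 linearZ /= !mxE mulrC.
pose h (x : 'cV[R]_d) : R := (y *m x) 0 0.
have hlin : scalar h by move=> k u w; rewrite /h mulmxDr -scalemxAr !mxE.
pose hL := GRing.isLinear.Build R 'cV[R]_d R *%R h hlin.
exists (HB.pack h hL : {scalar 'cV[R]_d}); apply/rowP => i; rewrite !mxE /=.
by rewrite /h !mxE; congr sgz; apply: eq_bigr => j _; rewrite !mxE.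
Qed.

Lemma sgz_sub_le (R : realDomainType) (v a : R) : `|a| <= `|v| ->
  sgz (v - a) = 0 \/ sgz (v - a) = sgz v.
Proof.
have [v0|v0|->] := ltgtP v 0; last first.
- by rewrite normr0 normr_le0 => /eqP ->; rewrite subr0; right.
- rewrite (gtr0_norm v0) ler_norml => /andP[_]; rewrite le_eqVlt.
  case/predU1P => [->|av]; first by left; rewrite subrr sgz0.
  by right; rewrite (gtr0_sgz v0) gtr0_sgz // subr_gt0.
rewrite (ltr0_norm v0) ler_norml opprK => /andP[]; rewrite le_eqVlt.
case/predU1P => [->|va] _; first by left; rewrite subrr sgz0.
by right; rewrite (ltr0_sgz v0) ltr0_sgz // subr_lt0.
Qed.

Lemma sign_le_trans (n : nat) (X Y Z : 'rV[int]_n) :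
  sign_le X Y -> sign_le Y Z -> sign_le X Z.
Proof.
move=> XY YZ i; case: (XY i) => [|Xi]; first by left.
by rewrite Xi; exact: YZ.
Qed.

Definition suppx (n : nat) (x : 'rV[int]_n) : {set 'I_n} :=
  [set i | x 0 i != 0]%SET.

Lemma suppx_proper (n : nat) (X Y : 'rV[int]_n) k :
  (forall i, Y 0 i = 0 -> X 0 i = 0) -> Y 0 k != 0 -> X 0 k = 0 ->
  (#|suppx X| < #|suppx Y|)%N.
Proof.
move=> XY Yk Xk; apply: proper_card; apply/fintype.properP; split.
  by apply/fintype.subsetP => i; rewrite !inE; apply: contraNneq => /XY ->.
by exists k; rewrite !inE // Xk eqxx.
Qed.

(** Induction on the support: a nonzero covector below [X] and distinct from it vanishes wherever
    they differ, so its support is strictly smaller. *)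
Lemma exists_cocircuit_le (n : nat) (O : orientedMatroid n) (X : 'rV[int]_n) :
  covectors O X -> X <> 0 -> exists2 Y, cocircuits O Y & sign_le Y X.
Proof.
have [m] := ubnP #|suppx X|; elim: m X => // m IH X leX OX X0.
have [minX|] := pselect (forall Y, covectors O Y -> Y <> 0 -> sign_le Y X -> Y = X).
  by exists X => // i; right.
move=> /existsNP[Y /not_implyP[OY /not_implyP[Y0 /not_implyP[YX neq]]]].
have [k Yk] : exists k, Y 0 k != X 0 k.
  apply/existsP; apply: contra_notT neq; rewrite negb_exists => /forallP YXk.
  by apply/rowP => k; apply/eqP; have := YXk k; rewrite negbK.
have Yk0 : Y 0 k = 0 by case: (YX k) => // YXk; rewrite YXk eqxx in Yk.
have [|//|//|Z OZ ZY] := IH Y; last first.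
  by exists Z => //; exact: sign_le_trans ZY YX.
apply: leq_trans (leX : (_ <= m)%N); apply: (suppx_proper (k := k)) => //.
  by move=> i Xi; case: (YX i) => // ->.
by rewrite -Yk0 eq_sym.
Qed.

(** * Comparison of the row lattice with the cocircuits *)

Section RowLattice.
Variables (R : realType) (d n : nat) (M : 'M[int]_(d, n)).
Hypothesis uM : unimodular M.
Let O := mx_oriented_matroid (map_mx intr M : 'M[R]_(d, n)).

(* Let X be the sign vector of v and w a sign vector of the row lattice
   supported in the support of v.  Cancelling from v, with a multiple of w, an
   entry of smallest absolute value on the support of w gives a covector below
   X with strictly smaller support.  Minimality of X makes it zero, so
   X = w or X = - w. *)
Lemma cocircuit_in_row_lattice (X : 'rV[int]_n) :
  cocircuits O X -> exists y : 'rV[int]_d, X = y *m M.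
Proof.
move=> [/mx_covectorsP[v vM XE] X0 minX].
have v0 : v != 0.
  by apply/eqP => v0; apply: X0; rewrite XE v0; apply/rowP => i; rewrite !mxE sgz0.
have [y [e [we ws w0]]] := sign_vector_in_support uM vM v0.
set w := y *m M in we ws w0.
have w1 i : w 0 i != 0 -> `|w 0 i| = 1.
  by have := ws i; rewrite !inE => /or3P[]/eqP ->.
have Pe : w 0 e != 0 by rewrite we.
case: (@arg_minP _ _ _ e (fun k => w 0 k != 0) (fun k => `|v 0 k|) Pe) => k wk mink.
(* As [w 0 k] is 1 or -1, it is its own inverse, so [t] is the quotient of [v 0 k] by [w 0 k]. *)
pose t : R := v 0 k * (w 0 k)%:~R.
pose u : 'rV[R]_n := v - t *: map_mx intr w.
have uM' : (u <= (map_mx intr M : 'M[R]_(d, n)))%MS.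
  by rewrite addmx_sub // eqmx_opp scalemx_sub // map_mxM submxMl.
have uE i : u 0 i = v 0 i - t * (w 0 i)%:~R by rewrite !mxE.
have uk : u 0 k = 0.
  rewrite uE /t -mulrA -intrM -expr2 -[_ ^+ 2]real_normK ?num_real //.
  by rewrite w1 // mulr1 subrr.
have vk : v 0 k != 0 by apply: contraNneq wk => /w0 ->.
have u0 : u = 0.
  apply: contrapT => u0; have /rowP/(_ k) : \row_i sgz (u 0 i) = X.
    apply: minX; first by apply/mx_covectorsP; exists u.
    - move=> su; apply: u0; apply/rowP => i; have /rowP/(_ i) := su.
      by rewrite !mxE => /eqP; rewrite sgz_eq0 => /eqP.
    - move=> i; rewrite XE [X in X = 0]mxE [X in _ \/ X = _]mxE
        [X in _ \/ _ = X]mxE !uE.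
      (* The choice of [k] gives [|t| <= |v 0 i|] on the support of [w], so the subtraction reverses
         no sign. *)
      apply: sgz_sub_le; have [->|wi] := eqVneq (w 0 i) 0.
        by rewrite mulr0 normr0.
      rewrite normrM -intr_norm w1 // mulr1 /t normrM -intr_norm w1 // mulr1.
      exact: mink.
  by rewrite XE mxE [RHS]mxE uk sgz0 => /esym/eqP; rewrite sgz_eq0 (negPf vk).
exists (sgz t *: y); rewrite -scalemxAl -/w XE; apply/rowP => i.
have /eqP := uE i; rewrite u0 [X in X == _]mxE eq_sym subr_eq0 => /eqP vi.
rewrite [LHS]mxE [RHS]mxE vi sgzM; congr (_ * _).
by have := ws i; rewrite !inE => /or3P[]/eqP ->; rewrite ?sgz0 ?sgz1 // mulrN1z sgzN1.
Qed.

Lemma row_lattice_in_cocircuits (y : 'rV[int]_d) :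
  subgroup_generated (cocircuits O) (y *m M).
Proof.
have [m] := ubnP #|suppx (y *m M)|; elim: m y => // m IH y lem.
have [x0|/eqP x0] := eqVneq (y *m M) 0.
  by rewrite x0; exact: subgroup_generated0.
pose S := \row_i sgz ((map_mx intr (y *m M) : 'rV[R]_n) 0 i).
have SE i : (S 0 i == 0) = ((y *m M) 0 i == 0).
  by rewrite mxE sgz_eq0 mxE intr_eq0.
have [] := @exists_cocircuit_le n O S.
- by apply/mx_covectorsP; exists (map_mx intr (y *m M)); rewrite // map_mxM submxMl.
- move=> S0; apply: x0; apply/rowP => i; apply/eqP.
  by rewrite [X in _ == X]mxE -SE S0 mxE.
move=> Y cY YS; have [z Yz] := cocircuit_in_row_lattice cY.
have [OY Y0 _] := cY.
have [k Yk] : exists k, Y 0 k != 0.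
  apply/existsP; apply: contra_notT Y0; rewrite negb_exists => /forallP Y0.
  by apply/rowP => k; apply/eqP; have := Y0 k; rewrite negbK mxE.
have YY : Y 0 k * Y 0 k = 1.
  by have := covector_sign OY k; rewrite !inE (negPf Yk) => /or3P[]// /eqP ->.
have xY i : (y *m M) 0 i = 0 -> Y 0 i = 0.
  by move/eqP; rewrite -SE => /eqP Si; case: (YS i) => // ->.
(* Since [Y 0 k] squares to 1, subtracting [c] times [Y] cancels entry [k]. No new support appears,
   as [Y] vanishes wherever [y *m M] does. *)
pose c := (y *m M) 0 k * Y 0 k.
have xE : y *m M = (y - c *: z) *m M + Y *~ c.
  by rewrite mulmxBl -scalemxAl -Yz scale_int_mulrz subrK.
have x'E i : ((y - c *: z) *m M) 0 i = (y *m M) 0 i - c * Y 0 i.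
  by rewrite mulmxBl -scalemxAl -Yz !mxE.
rewrite xE; apply: subgroup_generatedD; last first.
  by apply: subgroup_generated_mulrz; exact: sub_gen_smallest.
apply: IH; apply: leq_trans (lem : (_ <= m)%N); apply: (suppx_proper (k := k)).
- by move=> i xi; rewrite x'E xi (xY i xi) mulr0 subrr.
- by apply: contraNneq Yk => /xY ->.
- by rewrite x'E /c -mulrA YY mulr1 subrr.
Qed.

End RowLattice.

Theorem theorem11 (R : realType) (n d : nat) (O : orientedMatroid n)
    (M : 'M[int]_(d, n)) :
  regular_oriented_matroid R O ->
  unimodular M ->
  represents R M O ->
  subgroup_generated (range (fun i : 'I_d => row i M)) =
  subgroup_generated (cocircuits O).
Proof.
move=> _ uM ->; apply/seteqP; split; apply: subgroup_generated_sub.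
  by move=> _ [i _ <-]; rewrite rowE; exact: row_lattice_in_cocircuits.
move=> X /(cocircuit_in_row_lattice uM)[y ->].
exact: subgroup_generated_mulmx.
Qed.
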